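(* Let $(X,\mathcal{E})$ be a coarse space and let $\mathcal{X}=\{X_\alpha\}_\alpha$ be a family of coarse subspaces of $X$ with $X=\bigcup\mathcal{X}$. Suppose that for each entourage $L\in\mathcal{E}$ there is $Y_L\subseteq X$ such that $\mathcal{X}_L=\{X_\alpha\setminus Y_L\}_\alpha$ forms an $L$-disjoint collection. Then: (1) if $\mathcal{X}$ has finite weak coarse decomposition complexity and $Y_L$ has finite weak coarse decomposition complexity for all $L$, then $X$ has finite weak coarse decomposition complexity; (2) if $\mathcal{X}$ has finite coarse decomposition complexity and $Y_L$ has finite coarse decomposition complexity for all $L$, then $X$ has finite coarse decomposition complexity; (3) if $\mathcal{X}$ has straight finite coarse decomposition complexity and $Y_L$ has straight finite coarse decomposition complexity for all $L$, then $X$ has straight finite coarse decomposition complexity.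
   Context: A coarse structure on a set $X$ is a collection $\mathcal{E}$ of subsets of $X\times X$, called entourages, closed under subsets, finite unions, inverses $E^{-1}=\{(y,x)\mid (x,y)\in E\}$ and compositions $E_1\circ E_2=\{(x,z)\mid \exists y,\ (x,y)\in E_1,\ (y,z)\in E_2\}$, and containing the diagonal $\Delta_X$. The pair $(X,\mathcal{E})$ is a coarse space; subsets carry the restricted coarse structure. A family $\mathcal{U}$ of subsets is uniformly bounded if $\bigcup_{U\in\mathcal{U}}(U\times U)\in\mathcal{E}$, and $L$-disjoint if $(A\times B)\cap L=\emptyset$ whenever $A,B\in\mathcal{U}$, $A\neq B$. Let $\mathcal{Z},\mathcal{Y}$ be families of subsets of $X$ and $L\in\mathcal{E}$. For an integer $d\ge1$, a weak $(L,d)$-decomposition of a set $Z$ over $\mathcal{Y}$ is an expression $Z=Z^1\cup\cdots\cup Z^d$ where each $Z^i=\bigcup_j Z^i_j$ with all $Z^i_j\in\mathcal{Y}$, and, for each $i$, $Z^i_j\ne Z^i_{j'}$ implies $(Z^i_j\times Z^i_{j'})\cap L=\emptyset$. An $L$-decomposition is a weak $(L,2)$-decomposition. The family $\mathcal{Z}$ admits an $L$-decomposition (resp. weak $(L,d)$-decomposition) over $\mathcal{Y}$ if every $Z\in\mathcal{Z}$ does; write $\mathcal{Z}\xrightarrow{L}\mathcal{Y}$ for the former. Coarse decomposition game for a family $\mathcal{Z}$: set $\mathcal{Y}_0=\mathcal{Z}$. In round $i\ge1$, Player 1 asserts an entourage $L_i$ and Player 2 responds with a family $\mathcal{Y}_i$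 of subsets and an $L_i$-decomposition of $\mathcal{Y}_{i-1}$ over $\mathcal{Y}_i$. Player 2 wins if at some finite stage $\mathcal{Y}_i$ is uniformly bounded. In the weak coarse decomposition game, Player 2 instead responds with a positive integer $d_i$, a family $\mathcal{Y}_i$ and a weak $(L_i,d_i)$-decomposition of $\mathcal{Y}_{i-1}$ over $\mathcal{Y}_i$. The family $\mathcal{Z}$ has finite (resp. finite weak) coarse decomposition complexity if Player 2 has a winning strategy in the (resp. weak) game. It has straight finite coarse decomposition complexity if for any sequence of entourages $L_1\subseteq L_2\subseteq\cdots$ there is a finite sequence of families $\mathcal{Y}_1,\ldots,\mathcal{Y}_n$ of subsets such that, with $\mathcal{Y}_0=\mathcal{Z}$, $\mathcal{Y}_{i-1}\xrightarrow{L_i}\mathcal{Y}_i$ for $i=1,\ldots,n$ and $\mathcal{Y}_n$ is uniformly bounded. A space $Z$ has one of these properties if the family $\{Z\}$ does. *)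

(* Defs.v *)
From mathcomp Require Import all_boot.
From mathcomp Require Import boolp classical_sets.

Set Implicit Arguments.
Unset Strict Implicit.
Unset Printing Implicit Defensive.

Local Open Scope classical_set_scope.

(* The library writes E2 \; E1 for {(x, z) | exists y, (x, y) \in E1 and
   (y, z) \in E2}. Closure under empty unions follows from [entourages_sub]
   and [entourages_diag]. *)
Record coarse_structure (X : Type) := CoarseStructure {
  entourages : set (set (X * X));
  entourages_diag : entourages diagonal;
  entourages_sub : forall E F, entourages F -> E `<=` F -> entourages E;
  entourages_union : forall E F,
    entourages E -> entourages F -> entourages (E `|` F);
  entourages_inv : forall E, entourages E -> entourages (E^-1)%relation;
  entourages_comp : forall E1 E2,
    entourages E1 -> entourages E2 -> entourages (E2 \; E1)%relation
}.

(* All properties below are stated for families of subsets of X; a subset Z of X,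
   seen as a coarse space, has one of them if the family [set Z] does. *)
Definition uniformly_bounded (X : Type) (E : coarse_structure X)
    (U : set (set X)) : Prop :=
  entourages E (\bigcup_(A in U) (A `*` A)).

Definition L_disjoint (X : Type) (L : set (X * X)) (U : set (set X)) : Prop :=
  forall A B, U A -> U B -> A <> B -> (A `*` B) `&` L = set0.

(* [P i] is the set of the pieces Z^i_j; it may be empty, in which case Z^i is
   the empty set. *)
Definition weak_decomposition (X : Type) (L : set (X * X)) (d : nat)
    (Z : set X) (Y : set (set X)) : Prop :=
  exists P : 'I_d -> set (set X),
    [/\ forall i, P i `<=` Y,
        forall i, L_disjoint L (P i)
      & Z = \bigcup_i \bigcup_(A in P i) A].

Definition family_weak_decomposition (X : Type) (L : set (X * X)) (d : nat)
    (ZZ Y : set (set X)) : Prop :=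
  forall Z, ZZ Z -> weak_decomposition L d Z Y.

Definition family_decomposition (X : Type) (L : set (X * X))
    (ZZ Y : set (set X)) : Prop :=
  family_weak_decomposition L 2 ZZ Y.

(* A strategy of Player 2 computes the answer in round i from the moves
   [:: L_1; ...; L_i] of Player 1; Player 2's own earlier moves are determined
   by these. An infinite sequence L of moves of Player 1 is indexed from 0, so
   that L_i is [L i.-1], and the family Y_i reached after i rounds is computed
   from [mkseq L i] = [:: L 0; ...; L i.-1]. *)
Definition strategy (X : Type) : Type := seq (set (X * X)) -> set (set X).

Definition play (X : Type) (ZZ : set (set X)) (sigma : strategy X)
    (L : nat -> set (X * X)) (i : nat) : set (set X) :=
  if i is 0 then ZZ else sigma (mkseq L i).

(* The game stops as soon as Player 2 has won, so the answers only have to be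
   legal up to that round. *)
Definition winning_strategy (X : Type) (E : coarse_structure X)
    (ZZ : set (set X)) (sigma : strategy X) : Prop :=
  forall L : nat -> set (X * X), (forall i, entourages E (L i)) ->
  exists n : nat,
    [/\ 0 < n,
        forall i, i < n ->
          family_decomposition (L i) (play ZZ sigma L i) (play ZZ sigma L i.+1)
      & uniformly_bounded E (play ZZ sigma L n)].

Definition finite_cdc (X : Type) (E : coarse_structure X)
    (ZZ : set (set X)) : Prop :=
  exists sigma : strategy X, winning_strategy E ZZ sigma.

(* In the weak game the answer in round i also contains the integer d_i. *)
Definition weak_strategy (X : Type) : Type :=
  seq (set (X * X)) -> nat * set (set X).

Definition weak_play (X : Type) (ZZ : set (set X)) (sigma : weak_strategy X) :
    (nat -> set (X * X)) -> nat -> set (set X) :=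
  play ZZ (fun s => (sigma s).2).

Definition winning_weak_strategy (X : Type) (E : coarse_structure X)
    (ZZ : set (set X)) (sigma : weak_strategy X) : Prop :=
  forall L : nat -> set (X * X), (forall i, entourages E (L i)) ->
  exists n : nat,
    [/\ 0 < n,
        forall i, i < n ->
          0 < (sigma (mkseq L i.+1)).1 /\
          family_weak_decomposition (L i) (sigma (mkseq L i.+1)).1
            (weak_play ZZ sigma L i) (weak_play ZZ sigma L i.+1)
      & uniformly_bounded E (weak_play ZZ sigma L n)].

Definition finite_weak_cdc (X : Type) (E : coarse_structure X)
    (ZZ : set (set X)) : Prop :=
  exists sigma : weak_strategy X, winning_weak_strategy E ZZ sigma.

(* Only the values Y 0, ..., Y n matter. *)
Definition straight_finite_cdc (X : Type) (E : coarse_structure X)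
    (ZZ : set (set X)) : Prop :=
  forall L : nat -> set (X * X), (forall i, entourages E (L i)) ->
  (forall i, L i `<=` L i.+1) ->
  exists (n : nat) (Y : nat -> set (set X)),
    [/\ 0 < n,
        Y 0 = ZZ,
        forall i, i < n -> family_decomposition (L i) (Y i) (Y i.+1)
      & uniformly_bounded E (Y n)].

(* Main.v *)
(* In round 1, against L, Player 2 splits X into the L-disjoint pieces
   X_a \ Y_L and the single piece Y_L. From round 2 on, Player 2 plays the
   strategies for {X_a} and for {Y_L} side by side: every answer is cut down to
   subsets, a strategy that has already won answers with the trivial
   decomposition, and the larger of the two numbers d_i is used, the remaining
   Z^i being empty. *)
Require Import Defs.
From mathcomp Require Import all_boot.
From mathcomp Require Import boolp classical_sets.

Set Implicit Arguments.
Unset Strict Implicit.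
Unset Printing Implicit Defensive.

Local Open Scope classical_set_scope.

(** * Weak decompositions: adding classes and passing to subsets *)

Lemma weak_decompositionW (X : Type) (L : set (X * X)) (d d' : nat)
    (Z : set X) (U V : set (set X)) : d <= d' -> U `<=` V ->
  weak_decomposition L d Z U -> weak_decomposition L d' Z V.
Proof.
move=> dd' UV [P [PU PL ->]].
(* Indices below [d] keep their pieces; the classes from [d] on are empty. *)
exists (fun i => if insub (i : nat) is Some j then P j else set0); split.
- by move=> i A; case: insubP => [j _ _ /PU/UV|_ []].
- by move=> i; case: insubP => [j _ _|_ A B []]; first exact: PL.
- rewrite eqEsubset; split=> x [i _].
  + case=> A PA Ax; exists (widen_ord dd' i) => //; exists A => //.
    by have -> : insub (widen_ord dd' i : nat) = Some i by exact: valK.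
  + by case: insubP => [j _ _|_] [A PA Ax] //; exists j => //; exists A.
Qed.

Lemma weak_decomposition_refl (X : Type) (L : set (X * X)) (d : nat)
    (Z : set X) (U : set (set X)) : 0 < d -> U Z -> weak_decomposition L d Z U.
Proof.
move=> d_gt0 UZ; apply: (weak_decompositionW d_gt0 (@subset_refl _ U)).
exists (fun _ => [set Z]); split=> [i A -> //|i A B -> -> //|].
by rewrite bigcup_const ?bigcup_set1 //; exists ord0.
Qed.

(** The strategy for the sets [Xa a] has to treat their subsets left after removing [Y L]; closing
    families under subsets on both sides of each decomposition makes this possible. *)
Definition subsets_of (X : Type) (U : set (set X)) : set (set X) :=
  [set A | exists2 B, U B & A `<=` B].

Lemma family_weak_decomposition_subsets (X : Type) (L : set (X * X)) (d : nat)
    (U V : set (set X)) : family_weak_decomposition L d U V ->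
  family_weak_decomposition L d (subsets_of U) (subsets_of V).
Proof.
move=> UV A [B /UV[P [PV PL BE]] AB].
exists (fun i => [set C `&` A | C in P i]); split.
- by move=> i _ [C PC <-]; exists C; [exact: PV PC | exact: subIsetl].
(* Distinct traces on [A] come from distinct pieces, so disjointness is inherited. *)
- move=> i _ _ [C PC <-] [D PD <-] CD.
  have CDL : (C `*` D) `&` L = set0.
    by apply: (PL i) => // eqCD; apply: CD; rewrite eqCD.
  by rewrite -subset0 -CDL => -[x y] [[[/= Cx _] [Dy _]] Lxy].
- rewrite eqEsubset; split=> x.
  + move=> Ax; have := AB _ Ax; rewrite BE => -[i _ [C PC Cx]].
    by exists i => //; exists (C `&` A) => //; exists C.
  + by case=> i _ [_ [C _ <-] []].
Qed.

(** * Runs of the game: freezing, joining and shifting *)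

Section CoarseStructure.
Variables (X : Type) (E : coarse_structure X).
Implicit Types (L : nat -> set (X * X)) (V W : nat -> nat * set (set X)).

Lemma uniformly_bounded_subsets (U : set (set X)) :
  uniformly_bounded E U -> uniformly_bounded E (subsets_of U).
Proof.
move=> /entourages_sub; apply=> -[x y] [A [B UB AB] [/= Ax Ay]].
by exists B => //; split; apply: AB.
Qed.

Lemma uniformly_boundedU (U V : set (set X)) :
  uniformly_bounded E U -> uniformly_bounded E V ->
  uniformly_bounded E (U `|` V).
Proof.
by move=> bU bV; rewrite /uniformly_bounded bigcup_setU; exact: entourages_union.
Qed.

(** The admissible numbers [d_i]: all positive ones in the weak game, only 2 otherwise. One argument
    thus serves all three parts. *)
Variable ok : set nat.
Hypotheses (ok2 : ok 2) (ok_max : forall d d', ok d -> ok d' -> ok (maxn d d')).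

(* [V i] holds the number d_i and the family Y_i; [(V 0).1] plays no role in
   the game. *)
Definition winning_upto L V (n : nat) : Prop :=
  (forall i, i < n -> ok (V i.+1).1 /\
     family_weak_decomposition (L i) (V i.+1).1 (V i).2 (V i.+1).2) /\
  uniformly_bounded E (V n).2.

(** Legal forever and bounded from some round on, so that two runs won at different times can be
    merged round by round. *)
Definition winning_run L V : Prop :=
  [/\ forall i, ok (V i).1,
      forall i, family_weak_decomposition (L i) (V i.+1).1 (V i).2 (V i.+1).2
    & exists n, forall i, n <= i -> uniformly_bounded E (V i).2].

Lemma winning_run_upto L V :
  winning_run L V -> exists2 n, 0 < n & winning_upto L V n.
Proof. by case=> okV LV [n bV]; exists n.+1 => //; split; [split | exact: bV]. Qed.

(** Freezes the family once it is bounded. The value at [i] depends only on [V] up to [i], so that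
    freezing respects causality. *)
Fixpoint stop V (i : nat) : nat * set (set X) :=
  if i is j.+1 then
    if `[< uniformly_bounded E (stop V j).2 >] then (2, (stop V j).2) else V i
  else (2, (V 0).2).

Lemma eq_stop V W (i : nat) :
  (forall j, j <= i -> V j = W j) -> stop V i = stop W i.
Proof.
elim: i => [|i IHi] VW /=; first by rewrite VW.
by rewrite IHi ?VW // => j ji; apply: VW; exact: leqW.
Qed.

Lemma stop_bounded V (i j : nat) : i <= j ->
  uniformly_bounded E (stop V i).2 -> uniformly_bounded E (stop V j).2.
Proof.
move=> /subnK <- bV; elim: (j - i) => // k bk.
by rewrite addSn /= asboolT.
Qed.

Lemma stop_unbounded V (i : nat) :
  ~ uniformly_bounded E (stop V i).2 -> (stop V i).2 = (V i).2.
Proof. by case: i => //= i; case: asboolP. Qed.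

Lemma winning_run_stop L V (n : nat) :
  winning_upto L V n -> winning_run L (stop V).
Proof.
move=> [LV bV].
have bn : uniformly_bounded E (stop V n).2.
  (* An unbounded [stop V n] would not be frozen yet, hence would have the bounded family of
     [V n]. *)
  by apply: contrapT => /[dup] /stop_unbounded ->.
have lt_n i : ~ uniformly_bounded E (stop V i).2 -> i < n.
  by rewrite ltnNge => nb; apply/negP => /stop_bounded/(_ bn).
split=> [[|i] //=|i /=|].
- by case: asboolP => // /lt_n/LV[].
- case: asboolP => [_|nb]; first by move=> Z UZ; exact: weak_decomposition_refl.
  by rewrite stop_unbounded //; case: (LV _ (lt_n _ nb)).
- by exists n => i /stop_bounded; apply.
Qed.

(** The 2 in the maximum is for index 0, which becomes the first answer and needs one class for the
    sets [Xa a] cut down and one for [Y L]. *)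
Definition join V W (i : nat) : nat * set (set X) :=
  (maxn 2 (maxn (V i).1 (W i).1), subsets_of (V i).2 `|` subsets_of (W i).2).

Lemma winning_run_join L V W :
  winning_run L V -> winning_run L W -> winning_run L (join V W).
Proof.
move=> [okV LV [n bV]] [okW LW [m bW]]; split=> [i|i Z|].
- by do 2![apply: ok_max => //].
(* Each member is decomposed by the run it comes from; no disjointness between the two families is
   required. *)
- case=> [/(family_weak_decomposition_subsets (LV i))|
          /(family_weak_decomposition_subsets (LW i))];
  apply: weak_decompositionW;
  by [rewrite !leq_max leqnn !orbT | exact: subsetUl | exact: subsetUr].
- exists (maxn n m) => i; rewrite geq_max => /andP[ni mi].
  by apply: uniformly_boundedU; apply: uniformly_bounded_subsets; auto.
Qed.

(** The starting family of the later run [V] is the answer to the first move. *)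
Definition first_answer (Z : set X) V (i : nat) : nat * set (set X) :=
  if i is j.+1 then V j else (2, [set Z]).

Lemma winning_run_first_answer (Z : set X) L V :
  weak_decomposition (L 0) (V 0).1 Z (V 0).2 ->
  winning_run (fun i => L i.+1) V -> winning_run L (first_answer Z V).
Proof.
move=> ZV [okV LV [n bV]]; split=> [[|i] //|[|i]|]; first exact: okV; first by move=> _ ->.
  exact: LV.
by exists n.+1 => -[|i] //; exact: bV.
Qed.

Definition has_winning_strategy (U : set (set X)) : Prop :=
  exists sigma : weak_strategy X, forall L, (forall i, entourages E (L i)) ->
  exists2 n, 0 < n & winning_upto L
    (fun i => if i is 0 then (2, U) else sigma (mkseq L i)) n.

(** As [L j] is the move of round [j + 1], the answer of round [i] sees the moves with [j < i]. *)
Definition causal (F : (nat -> set (X * X)) -> nat -> nat * set (set X)) : Prop :=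
  forall L L' i, (forall j, j < i -> L j = L' j) -> F L i = F L' i.

(* Strategies in the form of causal maps on infinite sequences of moves, so that
   answers to shifted sequences can be combined without list surgery. *)
Definition has_winning_response (U : set (set X)) : Prop :=
  exists2 F, causal F & forall L, (forall i, entourages E (L i)) ->
  (F L 0).2 = U /\ winning_run L (F L).

Lemma has_winning_strategyP (U : set (set X)) :
  has_winning_strategy U <-> has_winning_response U.
Proof.
split=> [[sigma sigmaP]|[F Fcausal FP]].
- exists (fun L => stop (fun i => if i is 0 then (2, U) else sigma (mkseq L i))).
  + move=> L L' i LL'; apply: eq_stop => -[|j] ji //; congr sigma.
    apply/eq_in_map => k; rewrite mem_iota => /andP[_ kj].
    by apply: LL'; exact: leq_trans ji.
  + by move=> L /sigmaP[n _ /winning_run_stop].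
(* The finite list of moves is padded with [set0]; by causality the padding does not affect the
   answer. *)
- exists (fun s => F (nth set0 s) (size s)) => L EL.
  have FE i : F (nth set0 (mkseq L i)) (size (mkseq L i)) = F L i.
    by rewrite size_mkseq; apply: Fcausal => j ji; rewrite nth_mkseq.
  have [F0 /winning_run_upto[n n_gt0 [LF bF]]] := FP L EL.
  exists n => //; split=> [i /LF|]; last by case: n n_gt0 {LF} bF => // n _; rewrite FE.
  by rewrite FE; case: i => [|i]; rewrite ?FE ?F0.
Qed.

End CoarseStructure.

(** * The three complexity properties in terms of strategies and runs *)

Lemma finite_weak_cdcP (X : Type) (E : coarse_structure X) (U : set (set X)) :
  finite_weak_cdc E U <-> has_winning_strategy E [set d | 0 < d] U.
Proof.
split=> -[sigma sigmaP]; exists sigma => L /sigmaP.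
- case=> n [n_gt0 LV bV]; exists n => //.
  by split=> [i /LV|]; [case: i | case: n n_gt0 bV {LV}].
- case=> n n_gt0 [LV bV]; exists n; split=> //.
  + by move=> i /LV; case: i.
  + by case: n n_gt0 bV {LV}.
Qed.

Lemma finite_cdcP (X : Type) (E : coarse_structure X) (U : set (set X)) :
  finite_cdc E U <-> has_winning_strategy E [set 2] U.
Proof.
split=> [[sigma sigmaP]|[sigma sigmaP]].
- exists (fun s => (2, sigma s)) => L /sigmaP[n [n_gt0 LV bV]]; exists n => //.
  by split=> [i /LV|]; [case: i | case: n n_gt0 bV {LV}].
- exists (fun s => (sigma s).2) => L /sigmaP[n n_gt0 [LV bV]]; exists n; split=> //.
  + by move=> i /LV[/= ->]; case: i.
  + by case: n n_gt0 bV {LV}.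
Qed.

(** Here the run may depend on the whole sequence [L], so no causality is asked. *)
Lemma straight_finite_cdcP (X : Type) (E : coarse_structure X)
    (U : set (set X)) :
  straight_finite_cdc E U <->
  forall L, (forall i, entourages E (L i)) -> (forall i, L i `<=` L i.+1) ->
  exists2 V, (V 0).2 = U & winning_run E [set 2] L V.
Proof.
split=> straightU L EL incL.
- have [n [V [n_gt0 V0 LV bV]]] := straightU L EL incL.
  exists (stop E (fun i => (2, V i))) => //.
  by apply: (@winning_run_stop _ _ _ _ _ _ n) => //; split=> // i /LV.
- have [V V0 /winning_run_upto[n n_gt0 [LV bV]]] := straightU L EL incL.
  by exists n, (fun i => (V i).2); split=> // i /LV[/= ->].
Qed.

(** * The first round for the cover, and the combined strategy *)

Section Cover.
Variables (X : Type) (E : coarse_structure X) (I : Type) (Xa : I -> set X).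
Hypothesis X_cover : [set: X] = \bigcup_a Xa a.
Variable Y : set (X * X) -> set X.
Hypothesis Y_disjoint : forall L, entourages E L ->
  L_disjoint L (range (fun a => Xa a `\` Y L)).

Lemma cover_decomposition (L : set (X * X)) : entourages E L ->
  weak_decomposition L 2 [set: X]
    (subsets_of (range Xa) `|` subsets_of [set Y L]).
Proof.
move=> EL; exists (fun i : 'I_2 =>
  if i == ord0 then range (fun a => Xa a `\` Y L) else [set Y L]); split.
- move=> i A; case: eqP => _; first case.
  + move=> a _ <-; left; exists (Xa a); [by exists a | exact: subDsetl].
  + by move=> ->; right; exists (Y L).
- by move=> i; case: eqP => _; [exact: Y_disjoint | move=> A B -> ->].
- rewrite eqEsubset; split=> // x _.
  have [Yx|nYx] := pselect (Y L x).
    by exists ord_max => //; exists (Y L).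
  have : [set: X] x by [].
  rewrite X_cover => -[a _ ax].
  by exists ord0 => //; exists (Xa a `\` Y L) => //; exists a.
Qed.

Variable ok : set nat.
Hypotheses (ok2 : ok 2) (ok_max : forall d d', ok d -> ok d' -> ok (maxn d d')).

Lemma winning_run_cover (L : nat -> set (X * X)) V W : entourages E (L 0) ->
  (V 0).2 = range Xa -> winning_run E ok (fun i => L i.+1) V ->
  (W 0).2 = [set Y (L 0)] -> winning_run E ok (fun i => L i.+1) W ->
  winning_run E ok L (first_answer [set: X] (join V W)).
Proof.
move=> EL V0 runV W0 runW; apply: winning_run_first_answer => //.
  rewrite /= V0 W0.
  by apply: weak_decompositionW (cover_decomposition EL); rewrite ?leq_maxl.
exact: winning_run_join.
Qed.

Lemma has_winning_strategy_cover :
  has_winning_strategy E ok (range Xa) ->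
  (forall L, entourages E L -> has_winning_strategy E ok [set Y L]) ->
  has_winning_strategy E ok [set [set: X]].
Proof.
move=> /(has_winning_strategyP _ ok2)[F Fcausal FP] winY.
(* The first move selects the set [Y (L 0)], so responses are chosen for all [L] at once; a constant
   one keeps [G L] causal when [L] is no entourage. *)
have /choice[G GP] : forall L, exists G, causal G /\ (entourages E L ->
    forall M, (forall i, entourages E (M i)) ->
    (G M 0).2 = [set Y L] /\ winning_run E ok M (G M)).
  move=> L; have [EL|nEL] := pselect (entourages E L).
    by have /(has_winning_strategyP _ ok2)[G ? ?] := winY L EL; exists G.
  by exists (fun _ _ => (2, set0)).
apply/(has_winning_strategyP _ ok2).
pose tail (L : nat -> set (X * X)) i := L i.+1.
exists (fun L => first_answer [set: X] (join (F (tail L)) (G (L 0) (tail L)))).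
(* From round 1 on both sequences share the first move, hence the same [G (L 0)]. *)
- move=> L L' [|i] LL' //=; rewrite /join (LL' 0) //.
  have tailE j : j < i -> tail L j = tail L' j by move=> ji; exact: LL'.
  by rewrite (Fcausal _ _ _ tailE) ((GP _).1 _ _ _ tailE).
- move=> L EL; split=> //.
  have EtL i : entourages E (tail L i) by exact: EL.
  have [F0 runF] := FP _ EtL.
  have [G0 runG] := (GP (L 0)).2 (EL 0) _ EtL.
  exact: winning_run_cover.
Qed.

End Cover.

Theorem theorem4p18 (X : Type) (E : coarse_structure X)
    (I : Type) (Xa : I -> set X)
    (X_cover : [set: X] = \bigcup_a Xa a)
    (Y : set (X * X) -> set X)
    (Y_disjoint : forall L, entourages E L ->
       L_disjoint L (range (fun a => Xa a `\` Y L))) :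
  [/\ finite_weak_cdc E (range Xa) ->
      (forall L, entourages E L -> finite_weak_cdc E [set Y L]) ->
      finite_weak_cdc E [set [set: X]],
      finite_cdc E (range Xa) ->
      (forall L, entourages E L -> finite_cdc E [set Y L]) ->
      finite_cdc E [set [set: X]]
    & straight_finite_cdc E (range Xa) ->
      (forall L, entourages E L -> straight_finite_cdc E [set Y L]) ->
      straight_finite_cdc E [set [set: X]]].
Proof.
have max2 d d' : [set 2] d -> [set 2] d' -> [set 2] (maxn d d') by move=> -> ->.
split=> winX winY.
- apply/finite_weak_cdcP.
  apply: has_winning_strategy_cover X_cover _ Y_disjoint _ _ _ _ _ => //.
  + by move=> d d' d_gt0 _; rewrite /= leq_max d_gt0.
  + exact/finite_weak_cdcP.
  + by move=> L /winY/finite_weak_cdcP.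
- apply/finite_cdcP.
  apply: has_winning_strategy_cover X_cover _ Y_disjoint _ _ _ _ _ => //.
  + exact/finite_cdcP.
  + by move=> L /winY/finite_cdcP.
- apply/straight_finite_cdcP => L EL incL.
  (* The shifted sequence is still increasing, so straightness applies to it. *)
  have [V V0 runV] : exists2 V, (V 0).2 = range Xa &
      winning_run E [set 2] (fun i => L i.+1) V.
    exact: (straight_finite_cdcP _ _).1.
  have [W W0 runW] : exists2 W, (W 0).2 = [set Y (L 0)] &
      winning_run E [set 2] (fun i => L i.+1) W.
    by apply: (straight_finite_cdcP _ _).1 => //; exact: winY.
  exists (first_answer [set: X] (join V W)) => //.
  exact: (winning_run_cover X_cover Y_disjoint).
Qed.
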